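(* Let $Z$ be a uniformly convex Banach space, let $W \subset Z$ be a nonempty closed convex subset, and let $K : W \to W$ be a nonexpansive mapping with $F(K) \neq \emptyset$. Let $a, b \in (0,1)$ and let $\{\alpha_n\}$, $\{\beta_n\}$ be sequences with $\alpha_n, \beta_n \in (a,b) \subset (0,1)$ for all $n \in \mathbb{N}$. Let $s_1 \in W$ and let $\{s_n\}$ be defined for all $n \in \mathbb{N}$ by $$r_n = (1-\beta_n)s_n + \beta_n K s_n, \qquad s_{n+1} = (1-\alpha_n) r_n + \alpha_n K s_n .$$ If $K$ satisfies Condition (I), then $\{s_n\}$ converges strongly (in norm) to a fixed point of $K$.
   Context: $F(K) = \{w \in W : Kw = w\}$ denotes the set of fixed points of $K$, and $d(s, F(K)) = \inf\{\|s-t\| : t \in F(K)\}$. $K : W \to W$ is nonexpansive if $\|Kx - Ky\| \le \|x-y\|$ for all $x,y \in W$. $K$ satisfies Condition (I) if there exists a nondecreasing function $m : [0,\infty) \to [0,\infty)$ with $m(0) = 0$ and $m(i) > 0$ for all $i \in (0,\infty)$ such that $\|s - Ks\| \ge m(d(s, F(K)))$ for all $s \in W$. *)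

(* Defs.v *)
From mathcomp Require Import all_boot all_order all_algebra.
From mathcomp Require Import all_classical all_reals all_analysis.

Set Implicit Arguments.
Unset Strict Implicit.
Unset Printing Implicit Defensive.

Import Order.TTheory GRing.Theory Num.Theory.
Import numFieldNormedType.Exports.

Local Open Scope classical_set_scope.
Local Open Scope ring_scope.

Definition uniformly_convex (R : realType) (Z : normedModType R) : Prop :=
  forall eps : R, 0 < eps -> eps <= 2 ->
    exists2 delta : R, 0 < delta &
      forall x y : Z, `|x| <= 1 -> `|y| <= 1 -> eps <= `|x - y| ->
        `|2^-1 *: (x + y)| <= 1 - delta.

(* A self-map of W is a total map Z -> Z sending W into W; only its values on W
   are used below. *)
Section SelfMaps.
Context {R : realType} {Z : normedModType R} {W : set Z}.
Implicit Type K : {fun W >-> W}.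

Definition fixed_points K : set Z := [set w | W w /\ K w = w].

Definition nonexpansive K : Prop := 1.-lipschitz_W K.

(* [inf] is the usual infimum for nonempty [A], and inf set0 = 0. *)
Definition dist_to (s : Z) (A : set Z) : R := inf [set `|s - t| | t in A].

Definition condition_I K : Prop :=
  exists m : {fun [set x : R | 0 <= x] >-> [set x : R | 0 <= x]},
    [/\ forall x y : R, 0 <= x -> x <= y -> m x <= m y,
        m 0 = 0,
        forall i : R, 0 < i -> 0 < m i &
        forall s : Z, W s -> m (dist_to s (fixed_points K)) <= `|s - K s|].

End SelfMaps.

(* Main.v *)
Require Import Defs.
From mathcomp Require Import all_boot all_order all_algebra.
From mathcomp Require Import all_classical all_reals all_analysis.
From mathcomp Require Import ring lra.

Set Implicit Arguments.
Unset Strict Implicit.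
Unset Printing Implicit Defensive.

Import Order.TTheory GRing.Theory Num.Theory.
Import numFieldNormedType.Exports.

Local Open Scope classical_set_scope.
Local Open Scope ring_scope.

(** Substituting [r n] gives [s n.+1 = (1 - t n) *: s n + t n *: K (s n)] with
    [t n = 1 - (1 - alpha n) * (1 - beta n)] bounded away from 0 and 1, so the
    distance from [s n] to each fixed point is nonincreasing. If [s n] stayed at
    distance at least [d > 0] from the fixed points, Condition (I) would keep
    [`|s n - K (s n)|] above [m d], and uniform convexity would make the distance
    to a fixed point drop by a constant amount at each step, which is absurd.
    Hence [s n] gets arbitrarily close to the fixed points; as it never moves
    away from any of them, it is a Cauchy sequence, and its limit is fixed. *)

Lemma norm_conv_le (R : realType) (Z : normedModType R) (c t : R) (x y : Z) :
  0 <= t <= 1 -> `|x| <= c -> `|y| <= c -> `|(1 - t) *: x + t *: y| <= c.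
Proof.
move=> t01 xc yc; apply: (le_trans (ler_normD _ _)); rewrite !normrZ.
by rewrite !ger0_norm; nra.
Qed.

(** Carries the midpoint estimate on the unit ball to any radius [c] and any weight kept away from 0
    and 1. Since [eps] is relative to [c], one [delta] serves all radii. *)
Lemma uniformly_convex_conv (R : realType) (Z : normedModType R) (eps : R) :
  uniformly_convex Z -> 0 < eps <= 2 ->
  exists2 delta : R, 0 < delta &
    forall (c tau t : R) (x y : Z), 0 <= tau -> tau <= t <= 1 - tau ->
      `|x| <= c -> `|y| <= c -> eps * c <= `|x - y| ->
      `|(1 - t) *: x + t *: y| <= (1 - 2 * tau * delta) * c.
Proof.
move=> uc /andP[eps0 eps2]; have [delta d0 ucd] := uc _ eps0 eps2.
exists delta => // c tau t x y tau0.
have mid (u v : Z) : `|u| <= c -> `|v| <= c -> eps * c <= `|u - v| ->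
    `|2^-1 *: (u + v)| <= (1 - delta) * c.
  move=> uLc vLc uv.
  (* Rescaling by [c^-1] needs [0 < c]; a negative [c] contradicts the norm bounds, and [c = 0]
     forces [u = v = 0]. *)
  have [c0|c0|c0] := ltgtP 0 c.
  - have scale (z : Z) : `|c^-1 *: z| = c^-1 * `|z|.
      by rewrite normrZ gtr0_norm ?invr_gt0.
    have := ucd (c^-1 *: u) (c^-1 *: v).
    rewrite -scalerBr -scalerDr scalerA (mulrC 2^-1) -scalerA !scale.
    rewrite !(mulrC c^-1) !ler_pdivrMr// ler_pdivlMr// !mul1r.
    exact.
  - by have := normr_ge0 u; lra.
  - move: uLc vLc; rewrite -c0 !normr_le0 => /eqP -> /eqP ->.
    by rewrite addr0 scaler0 normr0 mulr0.
have half s (u v : Z) : tau <= s <= 2^-1 -> `|u| <= c -> `|v| <= c ->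
    eps * c <= `|u - v| -> `|(1 - s) *: u + s *: v| <= (1 - 2 * tau * delta) * c.
  move=> sb uLc vLc uv.
  (* For [s <= 2^-1] the point lies between [u] and the midpoint, which has weight [2 * s] and
     supplies the gain. *)
  have -> : (1 - s) *: u + s *: v =
      (1 - 2 * s) *: u + (2 * s) *: (2^-1 *: (u + v)).
    rewrite scalerA scalerDr addrA -scalerDl.
    by congr (_ *: _ + _ *: _); lra.
  move: (2^-1 *: (u + v)) (mid _ _ uLc vLc uv) => w wc.
  have s0 : 0 <= s by lra.
  have s1 : 0 <= 1 - 2 * s by lra.
  apply: (le_trans (ler_normD _ _)).
  rewrite !normrZ (ger0_norm s1) (ger0_norm s0) normr_nat.
  have c0 : 0 <= c by apply: le_trans uLc.
  have h1 : s * `|w| <= s * ((1 - delta) * c) by exact: ler_wpM2l.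
  have h2 : (1 - 2 * s) * `|u| <= (1 - 2 * s) * c by exact: ler_wpM2l.
  have h3 : tau * (delta * c) <= s * (delta * c).
    by apply: ler_wpM2r; [apply: mulr_ge0 => //; exact: ltW|lra].
  lra.
move=> tb xc yc xy.
have [t2|t2] := leP t 2^-1; first by apply: half => //; lra.
rewrite addrC; have {1}-> : t = 1 - (1 - t) by lra.
by apply: half; rewrite // 1?distrC//; lra.
Qed.

Section dist_to.
Context {R : realType} {Z : normedModType R}.
Implicit Types (A : set Z) (s t : Z).

Lemma dist_to_le A s t : A t -> dist_to s A <= `|s - t|.
Proof.
by move=> At; apply: ge_inf; [exists 0 => _ [u _ <-] | exists t].
Qed.

(** Nonemptiness matters: as [inf set0 = 0], an empty [A] would satisfy the inequality for every
    [e > 0]. *)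
Lemma dist_to_lt A s (e : R) :
  A !=set0 -> dist_to s A < e -> exists2 t, A t & `|s - t| < e.
Proof.
move=> [p Ap] /inf_lt[|_ [t At <-] ?]; first by exists `|s - p|, p.
by exists t.
Qed.

End dist_to.

Section nonexpansive.
Context {R : realType} {Z : normedModType R} {W : set Z}.
Variable K : {fun W >-> W}.
Hypothesis K_nonexp : nonexpansive K.

Lemma nonexpansive_le (x y : Z) : W x -> W y -> `|K x - K y| <= `|x - y|.
Proof. by move=> Wx Wy; have := @K_nonexp (x, y); rewrite /= mul1r; apply. Qed.

Lemma nonexpansive_fixed_le (p x : Z) :
  fixed_points K p -> W x -> `|K x - p| <= `|x - p|.
Proof. by move=> [Wp {1}<-] Wx; exact: nonexpansive_le. Qed.

(** Both [x] and [K x] lie within [|x - p|] of a fixed point [p], so [K] moves [x] by at most twice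
    that distance. *)
Lemma limit_fixed_points (x : Z) : W x ->
  (forall e : R, 0 < e -> exists2 p, fixed_points K p & `|x - p| < e) ->
  fixed_points K x.
Proof.
move=> Wx approx; split=> //; apply/eqP; rewrite -subr_eq0 -normr_le0.
apply/ler_addgt0Pl => e e0; rewrite addr0.
have [|p Fp xp] := approx (e / 2); first by lra.
apply: (le_trans (ler_distD p _ _)); rewrite (distrC p).
by have := nonexpansive_fixed_le Fp Wx; lra.
Qed.

End nonexpansive.

Section Krasnoselskii_Mann.
Context {R : realType} {Z : normedModType R} {W : set Z}.
Hypothesis Z_uc : uniformly_convex Z.
Hypothesis W_convex : convex_set W.
Variable K : {fun W >-> W}.
Hypothesis K_nonexp : nonexpansive K.
Variables (tau : R) (t : nat -> R) (s : nat -> Z).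
Hypothesis tau_gt0 : 0 < tau.
Hypothesis t_tau : forall n, tau <= t n <= 1 - tau.
Hypothesis s0_W : W (s 0).
Hypothesis s_def : forall n, s n.+1 = (1 - t n) *: s n + t n *: K (s n).

Let t01 n : 0 <= t n <= 1.
Proof. by have := t_tau n; have := tau_gt0; lra. Qed.

Lemma KM_in n : W (s n).
Proof.
elim: n => // n IHn; rewrite s_def.
have /andP[t0 t1] := t01 n.
have := @W_convex (K (s n)) (s n) (Itv01 t0 t1).
by rewrite !inE /conv/= addrC; apply=> //; exact: funS.
Qed.

Let step p n : s n.+1 - p = (1 - t n) *: (s n - p) + t n *: (K (s n) - p).
Proof.
rewrite s_def !scalerBr addrACA -opprD -scalerDl.
by rewrite (_ : 1 - t n + t n = 1) ?scale1r//; lra.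
Qed.

Lemma KM_fejer p m n :
  fixed_points K p -> (m <= n)%N -> `|s n - p| <= `|s m - p|.
Proof.
move=> Fp; elim: n => [|n IHn]; first by rewrite leqn0 => /eqP ->.
rewrite leq_eqVlt => /predU1P[<-//|/IHn]; apply: le_trans.
rewrite step; apply: norm_conv_le => //.
exact: nonexpansive_fixed_le (KM_in n).
Qed.

Lemma KM_dist_lt (d : R) : fixed_points K !=set0 -> condition_I K -> 0 < d ->
  exists n, dist_to (s n) (fixed_points K) < d.
Proof.
move=> F0 [m [m_nd _ m_gt0 m_le]] d0; apply: contrapT => /forallNP far.
have dist_ge n : d <= dist_to (s n) (fixed_points K).
  by rewrite leNgt; apply/negP/far.
have res_ge n : m d <= `|s n - K (s n)|.
  by apply: le_trans (m_le _ (KM_in n)); apply: m_nd => //; exact: ltW.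
have [p Fp] := F0.
have c_ge n : d <= `|s n - p| by apply: le_trans (dist_to_le _ Fp).
have Kc n : `|K (s n) - p| <= `|s n - p|.
  exact: nonexpansive_fixed_le (KM_in n).
have M0 : 0 < `|s 0 - p| by apply: lt_le_trans (c_ge 0).
(* The residual bound relative to the largest radius: as [|s n - p| <= |s 0 - p|],
   [eps * |s n - p| <= m d] for every [n], so [delta] does not depend on [n]. *)
pose eps := m d / `|s 0 - p|.
have eps_bnd : 0 < eps <= 2.
  rewrite divr_gt0 ?m_gt0//= ler_pdivrMr//.
  apply: (le_trans (res_ge 0)); apply: (le_trans (ler_distD p _ _)).
  by rewrite (distrC p); have := Kc 0; lra.
have [delta delta0 contr] := uniformly_convex_conv Z_uc eps_bnd.
(* The drop per step: the factor [1 - 2 * tau * delta] acts on a distance that is at least [d]. *)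
pose k := 2 * tau * delta * d.
have k0 : 0 < k by rewrite !mulr_gt0.
have dec n : `|s n - p| + n%:R * k <= `|s 0 - p|.
  elim: n => [|n IHn]; first by rewrite mul0r addr0.
  apply: le_trans IHn; rewrite step -natr1 mulrDl mul1r.
  suff: `|(1 - t n) *: (s n - p) + t n *: (K (s n) - p)| <=
      (1 - 2 * tau * delta) * `|s n - p|.
    have : k <= 2 * tau * delta * `|s n - p|.
      by rewrite ler_wpM2l// !mulr_ge0// ltW.
    lra.
  apply: contr => //; first exact: ltW.
  rewrite (_ : s n - p - (K (s n) - p) = s n - K (s n)); last first.
    by rewrite opprB addrA subrK.
  apply: le_trans (res_ge n); rewrite /eps mulrAC ler_pdivrMr//.
  by apply: ler_wpM2l; [exact/ltW/m_gt0|exact: KM_fejer].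
(* After this many steps the total drop exceeds the initial distance, contradicting
   [0 <= |s n - p|]. *)
pose n := Num.bound (`|s 0 - p| / k).
have : `|s 0 - p| / k < n%:R by apply: archi_boundP; rewrite divr_ge0// ltW.
rewrite ltr_pdivrMr//; have := dec n; have := normr_ge0 (s n - p); lra.
Qed.

End Krasnoselskii_Mann.

Theorem theorem3p5 (R : realType) (Z : completeNormedModType R)
    (Z_uc : uniformly_convex Z)
    (W : set Z) (W_neq0 : W !=set0) (W_closed : closed W)
    (W_convex : convex_set W)
    (K : {fun W >-> W}) (K_nonexp : nonexpansive K)
    (FK_neq0 : fixed_points K !=set0)
    (a b : R) (a01 : 0 < a < 1) (b01 : 0 < b < 1)
    (alpha beta : nat -> R)
    (alpha_ab : forall n, a < alpha n < b)
    (beta_ab : forall n, a < beta n < b)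
    (s r : nat -> Z) (s0_W : W (s 0%N))
    (r_def : forall n, r n = (1 - beta n) *: s n + beta n *: K (s n))
    (s_def : forall n,
      s n.+1 = (1 - alpha n) *: r n + alpha n *: K (s n))
    (K_I : condition_I K) :
  exists2 p : Z, fixed_points K p & s n @[n --> \oo] --> p.
Proof.
pose t n := 1 - (1 - alpha n) * (1 - beta n).
(* Here [t n = alpha n + beta n * (1 - alpha n) >= a], while [1 - t n = (1 - alpha n) * (1 - beta n)
   >= (1 - b) ^+ 2]. *)
pose tau := Num.min a ((1 - b) ^+ 2).
have tau0 : 0 < tau by rewrite lt_min exprn_gt0; lra.
have t_tau n : tau <= t n <= 1 - tau.
  have := alpha_ab n; have := beta_ab n => bn an.
  have : tau <= a by rewrite ge_min lexx.
  have : tau <= (1 - b) ^+ 2 by rewrite ge_min lexx orbT.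
  by rewrite /t; nra.
have s_KM n : s n.+1 = (1 - t n) *: s n + t n *: K (s n).
  rewrite s_def r_def scalerDr !scalerA -addrA -scalerDl /t.
  by congr (_ *: _ + _ *: _); ring.
have s_W := KM_in W_convex tau0 t_tau s0_W s_KM.
have fejer := KM_fejer W_convex K_nonexp tau0 t_tau s0_W s_KM.
(* A single [p] serves a whole tail: once some [s N] is within [e] of [p], monotonicity keeps all
   later terms there. These balls give both the Cauchy property and the fixed points approximating
   the limit. *)
have near_fixed (e : R) : 0 < e -> exists2 p, fixed_points K p &
    \forall n \near \oo, `|s n - p| < e.
  move=> e0; have [N] :=
    KM_dist_lt Z_uc W_convex K_nonexp tau0 t_tau s0_W s_KM FK_neq0 K_I e0.
  move=> /(dist_to_lt FK_neq0)[p Fp sNp]; exists p => //.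
  by exists N => // n /= Nn; apply: le_lt_trans sNp; exact: fejer.
have /cvg_ex[l sl] : cvgn s.
  apply: cauchy_cvg; apply: cauchy_exP => e /near_fixed[p _ sp]; exists p.
  by apply: filterS sp => n; rewrite -ball_normE/= distrC.
exists l => //; apply: limit_fixed_points => //.
  by apply: (closed_cvg W W_closed) sl; exact: nearW.
move=> e e0; have e20 : 0 < e / 2 by lra.
have [p Fp sp] := near_fixed _ e20.
exists p => //; near \oo => n.
apply: (le_lt_trans (ler_distD (s n) _ _)).
have : `|s n - p| < e / 2 by near: n.
have : `|l - s n| < e / 2 by near: n; exact: cvgr_dist_lt.
lra.
Unshelve. all: by end_near. Qed.
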